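(* There exists a (randomized) streaming algorithm that, given $n$ coins arriving one by one in a stream in arbitrary order, with gap parameter $\Delta>0$ and confidence parameter $\delta\in(0,1)$, finds the most biased coin with probability at least $1-\delta$ using $O\!\left(\frac{n}{\Delta^2}\cdot\log(1/\delta)\right)$ coin tosses and a memory of $\lceil\log^{*}(n)\rceil+1$ coins.
   Context: Streaming coin tossing. There are $n$ coins with unknown biases $p_1,\dots,p_n\in[0,1]$; each toss of the $i$-th coin is an independent Bernoulli$(p_i)$ random variable. The gap parameter $\Delta$ is the difference between the largest bias and the second largest bias; it is assumed that $\Delta>0$ (so the most biased coin is unique) and that $n,\Delta,\delta$ are known to the algorithm. The coins arrive one by one in a stream. At any time the algorithm may toss only the currently arriving coin or a coin explicitly stored in its memory; a coin that is not stored, or that is removed from memory, can no longer be tossed or recovered. The memory of the algorithm is the maximum number of coins it stores at any point (the currently arriving coin is not counted unless stored; auxiliary information such as counters is not counted). ''Finds the most biased coin'' means that at the end of the stream the algorithm outputs the coin with the largest bias. $\log^{*}(n)$ is the iterated logarithm (the number of times $\log_2$ must be applied to $n$ before the result is at most $1$). $O(\cdot)$ hides an absolute constant. *)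

(* Defs.v *)
From mathcomp Require Import all_boot all_order all_algebra finmap.
From mathcomp Require Import all_classical all_reals all_analysis.

Set Implicit Arguments.
Unset Strict Implicit.
Unset Printing Implicit Defensive.

Import Order.TTheory GRing.Theory Num.Theory.
Local Open Scope ring_scope.
Local Open Scope fmap_scope.

(* A coin the algorithm may access: the currently arriving one, or the one
   stored in the given memory slot.  The algorithm never sees coin identities. *)
Variant source := Current | Stored of nat.

(* A randomized streaming algorithm, as the tree of its possible interactions.
   Auxiliary information (counters, past outcomes) lives in the continuations
   and is free, as only stored coins count as memory.
   - [Toss s k]   toss the coin at [s] and continue with the outcome;
   - [Rand m k]   draw an internal uniform random element of {0, ..., m};
   - [Store s j k] put the coin at [s] in slot [j], evicting the one there;
   - [Discard j k] empty slot [j];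
   - [Next k]     let the next coin arrive, losing access to the current one
                  unless it is stored;
   - [Return j]   output the coin stored in slot [j]. *)
Inductive algorithm : Type :=
| Toss of source & (bool -> algorithm)
| Rand (m : nat) of ('I_m.+1 -> algorithm)
| Store of source & nat & algorithm
| Discard of nat & algorithm
| Next of algorithm
| Return of nat.

Record config (coin : Type) := Config {
  current : option coin;
  upcoming : seq coin;
  memory : {fmap nat -> coin} }.

Section Semantics.
Context {coin : eqType}.
Implicit Types (st : config coin) (A : algorithm).

Definition access st (s : source) : option coin :=
  match s with Current => current st | Stored j => (memory st).[? j] end.

(* A coin that cannot be accessed cannot be stored. *)
Definition store st (s : source) (j : nat) : config coin :=
  if access st s is Some c
  then Config (current st) (upcoming st) (memory st).[j <- c] else st.

Definition discard st (j : nat) : config coin :=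
  Config (current st) (upcoming st) (memory st).[~ j].

Definition advance st : config coin :=
  Config (ohead (upcoming st)) (behead (upcoming st)) (memory st).

Definition start (stream : seq coin) : config coin :=
  Config None stream [fmap].

(* The probability that A, run from st, outputs c.  Each toss of a coin c' is a
   fresh Bernoulli (p c') variable, independent of everything before it, whence
   the sum over its outcomes weighted by its mass function.  A run that tosses
   a coin it has no access to, or that returns from an empty slot or before the
   whole stream has arrived, outputs nothing. *)
Fixpoint output_prob {R : realType} (p : coin -> R) A st (c : coin) : R :=
  match A with
  | Toss s k =>
      if access st s is Some c' then
        \sum_(b : bool) bernoulli_pmf (p c') b * output_prob p (k b) st c
      else 0
  | Rand m k => (\sum_(i < m.+1) output_prob p (k i) st c) / m.+1%:R
  | Store s j k => output_prob p k (store st s j) c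
  | Discard j k => output_prob p k (discard st j) c
  | Next k => output_prob p k (advance st) c
  | Return j =>
      if nilp (upcoming st) && ((memory st).[? j] == Some c) then 1 else 0
  end.

(* The maximum number of coins stored at any point, over all toss outcomes and
   internal random choices. *)
Fixpoint peak_memory A st : nat :=
  maxn #|` domf (memory st) |
    match A with
    | Toss s k => \max_(b : bool) peak_memory (k b) st
    | Rand m k => \max_(i < m.+1) peak_memory (k i) st
    | Store s j k => peak_memory k (store st s j)
    | Discard j k => peak_memory k (discard st j)
    | Next k => peak_memory k (advance st)
    | Return j => 0
    end%N.

End Semantics.

(* The maximum number of tosses over all toss outcomes and internal random
   choices. *)
Fixpoint tosses (A : algorithm) : nat :=
  match A with
  | Toss s k => (\max_(b : bool) tosses (k b)).+1
  | Rand m k => \max_(i < m.+1) tosses (k i)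
  | Store _ _ k | Discard _ k | Next k => tosses k
  | Return _ => 0
  end%N.

(* Largest minus second largest bias, with multiplicity.  For n = 1 there is no
   second coin, and the default value of nth makes it count as bias 0. *)
Definition gap {R : realType} {n : nat} (p : 'I_n -> R) : R :=
  let s := sort >=%R (codom p) in s`_0 - s`_1.

Definition log2 {R : realType} (x : R) : R := ln x / ln 2.

Lemma ex_log_star {R : realType} (x : R) : exists k, iter k log2 x <= 1.
Proof.
have [N] : exists N : nat, x <= N.+1%:R.
  exists (Num.bound `|x|); apply: le_trans (ler_norm x) _.
  apply: le_trans (ltW (archi_boundP (normr_ge0 x))) _.
  by rewrite ler_nat.
elim: N x => [|N IHN] x lexN; first by exists 0%N.
have [lex1 | lt1x] := leP x 1; first by exists 0%N.
have ln2_gt0 : 0 < ln 2 :> R by rewrite ln_gt0 // ltr1n.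
have [|k lek1] := IHN (log2 x); last by exists k.+1; rewrite iterSr.
rewrite /log2 ler_pdivrMr // mulr_natl -lnXn // ler_ln ?posrE ?exprn_gt0 //.
  by apply: le_trans lexN _; rewrite -natrX ler_nat ltn_expl.
exact: lt_trans ltr01 lt1x.
Qed.

(* The iterated logarithm; being a natural number, it is its own ceiling. *)
Definition log_star {R : realType} (x : R) : nat := ex_minn (ex_log_star x).

(* Main.v *)
Require Import Defs.
From mathcomp Require Import all_boot all_order all_algebra finmap.
From mathcomp Require Import all_classical all_reals all_analysis.
From mathcomp Require Import lra ring zify.

Set Implicit Arguments.
Unset Strict Implicit.
Unset Printing Implicit Defensive.

Import Order.TTheory GRing.Theory Num.Theory.
Local Open Scope ring_scope.

(** One stored coin, the king, is enough.  The king holds a budget [B] of rounds;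
    each arrival adds [b] to it and starts a duel, in which king and challenger
    are both tossed once per round, until the king leads by [h] successes (he
    stays, with the budget left over) or the budget is used up (the challenger
    becomes king, with budget [b]).  Let [s = 1 + Delta / 2],
    [r = 1 - Delta ^ 2 / 6], and let [D] be the lead the king still lacks.  When
    the best coin is king, [r ^ B * s ^ D] is a supermartingale, it is at least
    [1] when he is dethroned, and it does not increase when a duel starts since
    [r ^ b * s ^ h <= 1]; so he is ever dethroned with probability at most
    [r ^ b].  When the best coin is the challenger, [s ^ - D] is a
    supermartingale, so he loses with probability at most [s ^ - h].  Only granted
    rounds are played, so there are at most [6 b (n - 1)] tosses; it suffices to take
    [h], [b] of order [ln (1 / delta) / Delta], [ln (1 / delta) / Delta ^ 2].

    For [delta] near [1] the toss bound tends to [0]: there only the arrivals in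
    a random residue class modulo about [1 / (2 (1 - delta))] are considered, and
    among them the best coin is found with probability [1 / 2]. *)

(* [B] is the number of rounds left and [D] the lead that the king, in slot 0,
   still lacks over the current coin. *)
Fixpoint duel (win : nat -> algorithm) (lose : algorithm) (B D : nat)
    {struct B} : algorithm :=
  if D is D'.+1 then
    if B is B'.+1 then
      Toss (Stored 0) (fun x => Toss Current (fun y =>
        duel win lose B' (if x == y then D else if x then D' else D.+1)))
    else lose
  else win B.

(* [m] marks the arrivals to be considered; the others are skipped. *)
Fixpoint reign (b h : nat) (m : bitseq) (B : nat) : algorithm :=
  match m with
  | [::] => Return 0
  | false :: m' => Next (reign b h m' B)
  | true :: m' =>
      Next (duel (reign b h m') (Store Current 0 (reign b h m' b)) (B + b) h)
  end.

Fixpoint contest (b h : nat) (m : bitseq) : algorithm :=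
  match m with
  | [::] => Return 0
  | false :: m' => Next (contest b h m')
  | true :: m' => Next (Store Current 0 (reign b h m' b))
  end.

(** * Memory and tosses, over all runs *)

Fixpoint stores_within (J : {fset nat}) (A : algorithm) : Prop :=
  match A with
  | Toss _ k => forall b, stores_within J (k b)
  | Rand _ k => forall i, stores_within J (k i)
  | Store _ j k => j \in J /\ stores_within J k
  | Discard _ k | Next k => stores_within J k
  | Return _ => True
  end.

Lemma peak_memory_le (coin : eqType) (J : {fset nat}) (A : algorithm)
    (st : config coin) :
  (domf (memory st) `<=` J)%fset -> stores_within J A ->
  (peak_memory A st <= #|` J|)%N.
Proof.
elim: A st => [s k IH|m k IH|s j k IH|j k IH|k IH|j] st memJ /=;
  rewrite geq_max fsubset_leq_card //=.
- by move=> kJ; apply/bigmax_leqP => b _; apply: IH.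
- by move=> kJ; apply/bigmax_leqP => i _; apply: IH.
- case=> jJ kJ; apply: IH => //; rewrite /store.
  by case: (access st s) => //= c; rewrite fsubUset fsub1set jJ memJ.
- have mem'J : (domf (memory st).[~ j]%fmap `<=` J)%fset.
    by rewrite domf_rem (fsubset_trans (fsubsetDl _ _)).
  exact: IH.
- by move=> kJ; apply: IH.
Qed.

Lemma stores_within_duel J win lose B D :
  (forall B', stores_within J (win B')) -> stores_within J lose ->
  stores_within J (duel win lose B D).
Proof.
by move=> winJ loseJ; elim: B D => [|B IHB] [|D] //= x y; apply: IHB.
Qed.

Lemma stores_within_reign b h m B : stores_within [fset 0%N]%fset (reign b h m B).
Proof.
elim: m B => [|[] m IHm] B //=; apply: stores_within_duel => //=.
by rewrite in_fset1.
Qed.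

Lemma stores_within_contest b h m : stores_within [fset 0%N]%fset (contest b h m).
Proof.
elim: m => [|[] m IHm] //=; rewrite in_fset1; split=> //.
exact: stores_within_reign.
Qed.

(** Unspent rounds are charged in advance at two tosses each, so a victorious king hands on a budget
    that is already paid for. *)
Lemma tosses_duel win lose B D t :
  (forall B', (tosses (win B') <= B'.*2 + t)%N) -> (tosses lose <= t)%N ->
  (tosses (duel win lose B D) <= B.*2 + t)%N.
Proof.
move=> win_le lose_le; elim: B D => [|B IHB] [|D] //=.
rewrite doubleS !addSn ltnS; apply/bigmax_leqP => x _.
by rewrite ltnS; apply/bigmax_leqP => y _; apply: IHB.
Qed.

(** A marked arrival costs at most [2 * b] tosses for the rounds it adds and [2 * b] for the fresh
    budget of a new king. *)
Lemma tosses_reign b h m B :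
  (tosses (reign b h m B) <= B.*2 + 4 * b * count id m)%N.
Proof.
elim: m B => [|[] m IHm] B //=.
have /leq_trans -> // : (tosses (duel (reign b h m)
    (Store Current 0 (reign b h m b)) (B + b) h)
    <= (B + b).*2 + (b.*2 + 4 * b * count id m))%N.
  apply: tosses_duel => [B'|]; last exact: IHm.
  by rewrite (leq_trans (IHm B')) // leq_add2l leq_addl.
by rewrite -!mul2n; nia.
Qed.

Lemma tosses_reign0 b h m B :
  count id m = 0%N -> tosses (reign b h m B) = 0%N.
Proof. by elim: m B => [|[] m IHm] B //=; apply: IHm. Qed.

Lemma tosses_contest b h m :
  (tosses (contest b h m) <= 6 * b * (count id m).-1)%N.
Proof.
elim: m => [|[] m IHm] //=.
(* With no further marked arrival the initial [b] rounds are never played; otherwise their [2 * b]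
   tosses raise [4 * b] to at most [6 * b] per arrival. *)
have [m0|m_gt0] := posnP (count id m); first by rewrite tosses_reign0.
by apply: leq_trans (tosses_reign _ _ _ _) _; rewrite -mul2n; nia.
Qed.

(** * Failure probability of a contest *)

Section Contest.
Context {R : realType} {coin : eqType} (p : coin -> R).
Hypothesis p01 : forall c, 0 <= p c <= 1.
Implicit Types (st : config coin) (c : coin).

Lemma output_prob_ge0 A st c : 0 <= output_prob p A st c.
Proof.
elim: A st => [s k IH|m k IH|s j k IH|j k IH|k IH|j] st //=.
- case: (access st s) => // c'; apply: sumr_ge0 => b _.
  by rewrite mulr_ge0 // bernoulli_pmf_ge0.
- by rewrite mulr_ge0 ?invr_ge0 ?ler0n ?sumr_ge0.
- by case: ifP.
Qed.

Let loss A st c := 1 - output_prob p A st c.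

Lemma loss_le1 A st c : loss A st c <= 1.
Proof. by rewrite lerBlDr lerDl output_prob_ge0. Qed.

(** Optional stopping: [f] bounds the loss at both exits of the duel and does not increase on
    average in a round. *)
Lemma loss_duel (f : nat -> nat -> R) win lose st c0 c1 c B D :
  current st = Some c1 -> ((memory st).[? 0] = Some c0)%fmap ->
  (forall B', loss (win B') st c <= f B' 0%N) ->
  (forall D', loss lose st c <= f 0%N D'.+1) ->
  (forall B' D', p c0 * (1 - p c1) * f B' D' + (1 - p c0) * p c1 * f B' D'.+2
     + (p c0 * p c1 + (1 - p c0) * (1 - p c1)) * f B' D'.+1
     <= f B'.+1 D'.+1) ->
  loss (duel win lose B D) st c <= f B D.
Proof.
move=> cur mem win_le lose_le fS; elim: B D => [|B IHB] [|D] //=.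
apply: le_trans (fS B D); rewrite /loss /= mem !big_bool /= cur !big_bool /=.
have [p0 p0'] := andP (p01 c0); have [p1 p1'] := andP (p01 c1).
have /(ler_wpM2l (mulr_ge0 p0 p1)) := IHB D.+1.
have /(ler_wpM2l (mulr_ge0 (_ : 0 <= 1 - p c0) (_ : 0 <= 1 - p c1))) := IHB D.+1.
rewrite !subr_ge0 => /(_ p0' p1').
have /(ler_wpM2l (mulr_ge0 p0 (_ : 0 <= 1 - p c1))) := IHB D.
rewrite !subr_ge0 => /(_ p1').
have /(ler_wpM2l (mulr_ge0 (_ : 0 <= 1 - p c0) p1)) := IHB D.+2.
rewrite !subr_ge0 => /(_ p0').
rewrite /loss.
set w0 := output_prob _ _ _ _; set w1 := output_prob _ _ _ _.
set w2 := output_prob _ _ _ _; lra.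
Qed.


Lemma walk_step (Delta x y : R) : 0 < Delta <= 1 ->
  0 <= x <= 1 -> 0 <= y <= 1 -> Delta <= x - y ->
  x * (1 - y) / (1 + Delta / 2) + (1 - x) * y * (1 + Delta / 2)
    + (x * y + (1 - x) * (1 - y)) <= 1 - Delta ^+ 2 / 6.
Proof.
move=> /andP[D0 D1] /andP[x0 x1] /andP[y0 y1] xy.
(* Locally [s] is [Delta / 2]. As [s <= 1 / 2], [a >= 2 / 3], and the decrease [s ^ 2 * a] found
   below is at least [Delta ^ 2 / 6]. *)
set s := Delta / 2; have s0 : 0 < 1 + s by rewrite /s; lra.
set a := (1 + s)^-1; have as1 : a * (1 + s) = 1 by rewrite mulVf ?gt_eqF.
have a0 : 0 < a by rewrite invr_gt0.
have a23 : 2 / 3 <= a by rewrite /s in as1; nra.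
have v1 : (1 - x) * y <= 1 by nra.
have v0 : 0 <= (1 - x) * y by nra.
(* With [v = (1 - x) * y] and [w = x - y], the left side becomes [1 + s * a * (v * s - w)], where
   [v * s - w <= s - Delta = - s]. *)
have -> : x * (1 - y) = (1 - x) * y + (x - y) by ring.
have -> : x * y + (1 - x) * (1 - y) = 1 - 2 * ((1 - x) * y) - (x - y) by ring.
move: (_ * y) v0 v1 (x - y) xy => v v0 v1 w vw.
have aE : a = 1 - s * a by lra.
have -> : (v + w) * a + v * (1 + s) + (1 - 2 * v - w)
  = 1 + s * (v - (v + w) * a) + (v + w) * (a - 1 + s * a) by ring.
have -> : a - 1 + s * a = 0 by lra.
rewrite mulr0 addr0.
have le1 : v - (v + w) * a <= - (a * s).
  have -> : v - (v + w) * a = a * (v * s - w) by have := congr1 ( *%R v) aE; lra.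
  by rewrite -mulrN ler_pM2l // /s; nra.
have : s * (v - (v + w) * a) <= s * - (a * s) by rewrite ler_pM2l // /s; lra.
have : Delta ^+ 2 / 6 <= s * (a * s).
  have -> : s * (a * s) = Delta ^+ 2 * a / 4 by rewrite /s; field.
  by have := ler_pM2l (exprn_gt0 2 D0) (2/3) a; rewrite a23; lra.
lra.
Qed.

Variables (Delta : R) (best : coin) (b h : nat).
Hypothesis Delta01 : 0 < Delta <= 1.
Hypothesis gapP : forall c, c != best -> Delta <= p best - p c.

Let s : R := 1 + Delta / 2.
Let r : R := 1 - Delta ^+ 2 / 6.
Hypothesis refill : r ^+ b * s ^+ h <= 1.

Let s_gt0 : 0 < s.
Proof. by have /andP[? ?] := Delta01; rewrite /s; lra. Qed.

Let r_gt0 : 0 < r.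
Proof. by have /andP[? ?] := Delta01; rewrite /r; nra. Qed.

Let r_le1 : r <= 1.
Proof. by rewrite /r gerBl; have := sqr_ge0 Delta; lra. Qed.

(** The bound is the potential at [D = 0] with the leftover budget, so the estimates of successive
    duels chain. *)
Lemma loss_reign_best m B st :
  ((memory st).[? 0] = Some best)%fmap -> size (upcoming st) = size m ->
  best \notin upcoming st -> loss (reign b h m B) st best <= r ^+ B.
Proof.
elim: m B st => [|x m IHm] B [cur up mem] /= memb.
  by case: up => //= _ _; rewrite /loss /= memb eqxx subrr exprn_ge0 // ltW.
case: up => //= c up [size_up]; rewrite in_cons negb_or eq_sym => /andP[cb nb].
case: x => /=; last exact: IHm.
have -> : loss (Next (duel (reign b h m) (Store Current 0 (reign b h m b))
    (B + b) h)) (Config cur (c :: up) mem) best =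
  loss (duel (reign b h m) (Store Current 0 (reign b h m b)) (B + b) h)
    (Config (Some c) up mem) best by [].
apply: (@le_trans _ _ (r ^+ (B + b) * s ^+ h)); last first.
  by rewrite exprD -mulrA ler_piMr // exprn_ge0 // ltW.
apply: (@loss_duel (fun B D => r ^+ B * s ^+ D) _ _ _ best c) => //.
- by move=> B'; rewrite mulr1; apply: IHm.
- move=> D'; apply: le_trans (loss_le1 _ _ _) _; rewrite mul1r.
  by apply: exprn_ege1; rewrite /s; have /andP[? ?] := Delta01; lra.
- move=> B' D'.
  have := walk_step Delta01 (p01 best) (p01 c) (gapP cb).
  rewrite -/s -/r => /(ler_wpM2l (ltW (mulr_gt0 (exprn_gt0 B' r_gt0)
    (exprn_gt0 D'.+1 s_gt0)))).
  congr (_ <= _); rewrite !exprS; last by ring.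
  by field; rewrite gt_eqF.
Qed.

(** The two terms pay for the best coin losing its duel as challenger and for its being dethroned
    later. *)
Lemma loss_reign_other m B st c0 :
  ((memory st).[? 0] = Some c0)%fmap -> size (upcoming st) = size m ->
  uniq (upcoming st) -> c0 != best -> best \in mask m (upcoming st) ->
  loss (reign b h m B) st best <= s ^- h + r ^+ b.
Proof.
elim: m B c0 st => [|x m IHm] B c0 [cur up mem] /= mem0.
  by rewrite mask0s.
case: up => //= c up [size_up] /andP[nc uniq_up] c0b.
case: x => /=; last by apply: (IHm B c0 (Config (Some c) up mem)).
rewrite in_cons eq_sym => bm.
have -> : loss (Next (duel (reign b h m) (Store Current 0 (reign b h m b))
    (B + b) h)) (Config cur (c :: up) mem) best =
  loss (duel (reign b h m) (Store Current 0 (reign b h m b)) (B + b) h)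
    (Config (Some c) up mem) best by [].
have loseE st' : loss (Store Current 0 (reign b h m b)) st' best =
  loss (reign b h m b) (store st' Current 0) best by [].
have [cb|cb] := eqVneq c best; last first.
  rewrite (negPf cb) /= in bm.
  (* Until the best coin arrives it does not matter who is king: a constant potential works. *)
  apply: (@loss_duel (fun B D => s ^- h + r ^+ b) _ _ _ c0 c) => //.
  - by move=> B'; apply: (IHm B' c0 (Config (Some c) up mem)).
  - move=> _; rewrite loseE.
    apply: (IHm b c (Config (Some c) up mem.[0%N <- c]%fmap)) => //=.
    by rewrite fnd_set eqxx.
  - by move=> _ _; rewrite le_eqVlt; apply/orP; left; apply/eqP; ring.
rewrite {}cb in nc bm *.
apply: (@loss_duel (fun B D => s ^- D + r ^+ b) _ _ _ c0 best) => //.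
- move=> B'; apply: le_trans (loss_le1 _ _ _) _.
  by rewrite expr0 invr1 lerDl exprn_ge0 // ltW.
- move=> D'; rewrite loseE; apply: (@le_trans _ _ (r ^+ b)); last first.
    by rewrite lerDr invr_ge0 exprn_ge0 // ltW.
  by apply: loss_reign_best => //=; rewrite fnd_set eqxx.
- move=> B' D'.
  have := walk_step Delta01 (p01 best) (p01 c0) (gapP c0b).
  (* The best coin is now the challenger; the potential ignores [B], so only a factor at most [1] is
     needed. *)
  rewrite -/s -/r => /le_trans/(_ r_le1).
  move=> /(ler_wpM2l (ltW (exprn_gt0 D'.+1 (_ : 0 < s^-1)))).
  rewrite invr_gt0 => /(_ s_gt0); rewrite !exprVn => step.
  rewrite -subr_ge0; move: step; rewrite -subr_ge0.
  congr (_ <= _); rewrite !exprS !invfM; field.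
  by rewrite expf_neq0 ?gt_eqF.
Qed.

Lemma loss_contest m st :
  size (upcoming st) = size m -> uniq (upcoming st) ->
  best \in mask m (upcoming st) ->
  loss (contest b h m) st best <= s ^- h + r ^+ b.
Proof.
elim: m st => [|x m IHm] [cur up mem] /=; first by rewrite mask0s.
case: up => //= c up [size_up] /andP[nc uniq_up].
case: x => /=; last by apply: (IHm (Config (Some c) up mem)).
rewrite in_cons eq_sym => bm.
have -> : loss (Next (Store Current 0 (reign b h m b)))
    (Config cur (c :: up) mem) best =
  loss (reign b h m b) (Config (Some c) up mem.[0%N <- c]%fmap) best by [].
have [cb|cb] := eqVneq c best; last first.
  rewrite (negPf cb) /= in bm.
  apply: (@loss_reign_other m b (Config (Some c) up mem.[0%N <- c]%fmap) c) => //=.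
  by rewrite fnd_set eqxx.
rewrite {}cb in nc bm *; apply: (@le_trans _ _ (r ^+ b)).
  by apply: loss_reign_best => //=; rewrite fnd_set eqxx.
by rewrite lerDr invr_ge0 exprn_ge0 // ltW.
Qed.

End Contest.

(** * The gap against individual biases *)

Lemma gap_le1 (R : realType) n (p : 'I_n -> R) :
  (forall i, 0 <= p i <= 1) -> gap p <= 1.
Proof.
move=> p01; rewrite /gap; set s := sort _ _.
have s01 k : 0 <= s`_k <= 1.
  (* For [n = 1] the second entry is the default [0], within range as well. *)
  have [lt_k|le_k] := ltnP k (size s); last by rewrite nth_default ?lexx ?ler01.
  have : s`_k \in s by apply: mem_nth.
  by rewrite mem_sort => /codomP[i ->].
by have /andP[_ ?] := s01 0%N; have /andP[? _] := s01 1%N; lra.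
Qed.

(** Both [c] and [best] contribute entries at least [p c], so the second largest entry is at least
    [p c]. *)
Lemma gap_le (R : realType) n (p : 'I_n -> R) (best c : 'I_n) :
  (forall i, p i <= p best) -> c != best -> gap p <= p best - p c.
Proof.
move=> p_le cb; rewrite /gap; set s := sort _ _.
have perm_s : perm_eq s (codom p) by rewrite perm_sort.
have size_s : size s = n by rewrite (perm_size perm_s) size_codom card_ord.
have sorted_s : sorted >=%R s by apply: sort_sorted => x y; apply: le_total.
have two : (1 < count (>= p c) s)%N.
  rewrite (permP perm_s) codomE count_map -size_filter.
  have -> : 2%N = size [:: c; best] by [].
  apply: uniq_leq_size => [|i]; first by rewrite /= inE cb.
  by rewrite !inE mem_filter mem_enum andbT => /orP[]/eqP-> /=.
have [k1 s1] : (1 < size s)%N /\ p c <= s`_1.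
  split; first exact: leq_trans two (count_size _ _).
  move: sorted_s two; case: s {perm_s size_s} => [|x0 [|x1 t]] //=.
    by case: (_ <= _).
  move=> /andP[_ sorted_t]; case: (leP (p c) x1) => // x1_lt.
  have := order_path_min (@ge_trans _ R) sorted_t.
  move=> /allP t_le.
  have -> : count (>= p c) t = 0%N.
    apply/eqP; rewrite -leqn0 leqNgt -has_count; apply/hasPn => y /t_le /= yx.
    by rewrite -ltNge (le_lt_trans yx).
  by case: (_ <= _).
have s0 : s`_0 <= p best.
  have : s`_0 \in s by apply: mem_nth; apply: ltnW.
  by rewrite (perm_mem perm_s) => /codomP[i ->].
lra.
Qed.

(** * Thinning the stream to a residue class *)

Definition residue_mask (M n : nat) (i : nat) : bitseq :=
  [seq j %% M == i | j <- iota 0 n]%N.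

(** Positions in one class have distinct quotients by [M], at most [(n - 1) / M + 1] of them; the
    predecessor absorbs the [+ 1]. *)
Lemma count_residue_mask M n i :
  ((count id (residue_mask M n i)).-1 * M <= n)%N.
Proof.
have [-> |M_gt0] := posnP M; first by rewrite muln0.
rewrite count_map -size_filter; set s := [seq _ <- _ | _].
have : (size s <= (n.-1 %/ M).+1)%N.
  rewrite -(size_iota 0 (n.-1 %/ M).+1) -(size_map (divn^~ M) s).
  apply: uniq_leq_size => [|_ /mapP[j + ->]].
    rewrite map_inj_in_uniq ?filter_uniq ?iota_uniq // => j k.
    rewrite !mem_filter /= => /andP[/eqP ji _] /andP[/eqP ki _] jk.
    by rewrite (divn_eq j M) (divn_eq k M) jk ji ki.
  rewrite mem_filter !mem_iota /= add0n => /andP[_ jn].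
  by rewrite ltnS leq_div2r //; lia.
have := leq_trunc_div n.-1 M; nia.
Qed.

Lemma mem_residue_mask (T : eqType) (s : seq T) x M n :
  size s = n -> uniq s -> x \in s ->
  x \in mask (residue_mask M n (index x s %% M)) s.
Proof.
move=> <- uniq_s xs; rewrite in_mask // xs /=.
by rewrite (nth_map 0%N) ?size_iota ?index_mem // nth_iota ?index_mem.
Qed.

(** * Numerical choice of lead and budget *)

Definition margin (R : realType) (Delta L : R) : nat :=
  (Num.truncn (3 * L / Delta)).+1.

(** Chosen so that [r ^ b <= exp (- h * Delta / 2)], which cancels
    [s ^ h <= exp (h * Delta / 2)]. *)
Definition budget (R : realType) (Delta L : R) : nat :=
  (Num.truncn (3 * (margin Delta L)%:R / Delta)).+1.

Section Calibration.
Context {R : realType} (Delta L : R).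
Hypotheses (Delta01 : 0 < Delta <= 1) (L_gt0 : 0 < L).
Let h := margin Delta L.
Let b := budget Delta L.


Lemma margin_gt : 3 * L < h%:R * Delta.
Proof. by have /andP[D0 _] := Delta01; rewrite -ltr_pdivrMr // truncnS_gt. Qed.

Lemma budget_gt : 3 * h%:R < b%:R * Delta.
Proof. by have /andP[D0 _] := Delta01; rewrite -ltr_pdivrMr // truncnS_gt. Qed.

Lemma margin_inv_le : (1 + Delta / 2) ^- h <= expR (- L).
Proof.
have /andP[D0 D1] := Delta01.
apply: (@le_trans _ _ (expR (- (Delta / 3)) ^+ h)).
  rewrite -exprVn lerXn2r ?nnegrE ?expR_ge0 ?invr_ge0 //; first by lra.
  (* [(1 - Delta / 3) * (1 + Delta / 2) >= 1] because [Delta <= 1]. *)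
  apply: le_trans (expR_ge1Dx _).
  rewrite -[leLHS]mul1r ler_pdivrMr; last by lra.
  by nra.
rewrite -expRM_natl ler_expR; have := margin_gt; lra.
Qed.

Lemma decay_le : (1 - Delta ^+ 2 / 6) ^+ b <= expR (- (h%:R * Delta / 2)).
Proof.
have /andP[D0 D1] := Delta01.
apply: (@le_trans _ _ (expR (- (Delta ^+ 2 / 6)) ^+ b)).
  rewrite lerXn2r ?nnegrE ?expR_ge0 //; first by nra.
  exact: expR_ge1Dx.
rewrite -expRM_natl ler_expR mulrN lerN2.
by have := ler_wpM2r (ltW D0) (ltW budget_gt); rewrite expr2; lra.
Qed.

Lemma budget_decay_le : (1 - Delta ^+ 2 / 6) ^+ b <= expR (- L).
Proof.
apply: le_trans decay_le _; rewrite ler_expR.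
by move: margin_gt L_gt0; lra.
Qed.

Lemma budget_refill :
  (1 - Delta ^+ 2 / 6) ^+ b * (1 + Delta / 2) ^+ h <= 1.
Proof.
have /andP[D0 D1] := Delta01.
have s_le : (1 + Delta / 2) ^+ h <= expR (h%:R * Delta / 2).
  rewrite -mulrA expRM_natl lerXn2r ?nnegrE ?expR_ge0 //; first by lra.
  exact: expR_ge1Dx.
apply: le_trans (ler_pM _ _ decay_le s_le) _.
- by rewrite exprn_ge0 //; nra.
- by rewrite exprn_ge0 //; lra.
- by rewrite -expRD addNr expR0.
Qed.

(** Undoing the truncations gives [b * Delta ^ 2 <= 9 * L + 4], and [4 <= 8 * L]. *)
Lemma budget_le : 1 / 2 <= L -> b%:R <= 17 * L / Delta ^+ 2.
Proof.
move=> L_ge; have /andP[D0 D1] := Delta01.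
have h_le : h%:R * Delta <= 3 * L + 1.
  rewrite /h /margin -natr1 mulrDl mul1r; apply: lerD => //.
  by rewrite -ler_pdivlMr // truncn_le divr_ge0 //; lra.
have b_le : b%:R * Delta <= 3 * h%:R + 1.
  rewrite /b /budget -natr1 mulrDl mul1r; apply: lerD => //.
  by rewrite -ler_pdivlMr // truncn_le divr_ge0 ?mulr_ge0 // ltW.
rewrite ler_pdivlMr ?exprn_gt0 // expr2 mulrA.
have := ler_wpM2r (ltW D0) b_le; lra.
Qed.

End Calibration.

(** * Confidence parameters near [1] *)

Lemma ln_ge_1BV (R : realType) (x : R) : 0 < x -> 1 - x^-1 <= ln x.
Proof.
move=> x0; rewrite -[x in ln x]invrK lnV ?posrE ?invr_gt0 //.
have := @le_ln1Dx R (x^-1 - 1); rewrite subrKC => H.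
have := invr_gt0 x; rewrite x0 => xV; have := H ltac:(lra); lra.
Qed.

(** The failure probability allowed to the contest itself, once the class of the best coin is
    drawn. *)
Definition confidence (R : realType) (delta : R) : R := Num.min delta (1 / 2).

(* One less than the modulus, as [Rand] takes the largest value to be drawn; it
   is [0], and nothing is skipped, when [delta <= 1 / 2]. *)
Definition dilution (R : realType) (delta : R) : nat :=
  (Num.truncn ((2 * (1 - delta))^-1)).-1.

(** Dividing by the modulus accounts for drawing the right class. For [delta > 1 / 2] the modulus is
    at most [1 / (2 * (1 - delta))]. *)
Lemma dilution_success (R : realType) (delta : R) : 0 < delta < 1 ->
  1 - delta <= (1 - confidence delta) / (dilution delta).+1%:R.
Proof.
move=> /andP[d0 d1]; rewrite /confidence /dilution.
set y := (2 * (1 - delta))^-1.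
have y0 : 0 < y by rewrite invr_gt0; lra.
have yE : y * (2 * (1 - delta)) = 1 by rewrite mulVf // gt_eqF //; lra.
have ty := truncn_le y; rewrite (ltW y0) in ty.
rewrite ler_pdivlMr ?ltr0n //.
have [d2|d2] := lerP delta (1 / 2).
  have t1 : (Num.truncn y <= 1)%N.
    by rewrite -(ler_nat R); apply: le_trans ty _; nra.
  have -> : (Num.truncn y).-1 = 0%N by lia.
  by lra.
have t1 : (0 < Num.truncn y)%N by rewrite truncn_gt_nat; nra.
by rewrite prednK //; nra.
Qed.

(** For [delta > 1 / 2] the inverse modulus is below [4 * (1 - delta) <= 4 * ln (1 / delta)], and
    [ln 4 <= 3]. Otherwise [ln 2 <= ln (1 / delta)] suffices. *)
Lemma dilution_cost (R : realType) (delta : R) : 0 < delta < 1 ->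
  ln (2 / confidence delta) / (dilution delta).+1%:R <= 12 * ln (1 / delta).
Proof.
move=> /andP[d0 d1]; rewrite /confidence /dilution.
set y := (2 * (1 - delta))^-1.
have y0 : 0 < y by rewrite invr_gt0; lra.
have yE : y * (2 * (1 - delta)) = 1 by rewrite mulVf // gt_eqF //; lra.
have dV : 1 < delta^-1 by rewrite invf_gt1.
have l1 : 1 - delta <= ln (1 / delta).
  by rewrite div1r; have := ln_ge_1BV (lt_trans ltr01 dV); rewrite invrK.
rewrite ler_pdivrMr ?ltr0n //.
have [d2|d2] := lerP delta (1 / 2).
  have ln2 : ln 2 <= ln (1 / delta).
    by rewrite ler_ln ?posrE ?divr_gt0 // ler_pdivlMr //; lra.
  rewrite (_ : 2 / delta = 2 * (1 / delta)); last by rewrite div1r.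
  rewrite lnM ?posrE ?divr_gt0 //.
  have : 12 * ln (1 / delta) * 1 <=
    12 * ln (1 / delta) * (Num.truncn y).-1.+1%:R.
    by rewrite ler_wpM2l ?ler1n //; lra.
  lra.
have ln4 : ln (2 / (1 / 2)) <= 3 :> R.
  have -> : 2 / (1 / 2) = 1 + 3 :> R by field.
  by apply: le_ln1Dx; lra.
apply: le_trans ln4 _.
have t1 : (0 < Num.truncn y)%N by rewrite truncn_gt_nat; nra.
rewrite prednK //; have := truncnS_gt y; rewrite -natr1.
have : (1 : R) <= (Num.truncn y)%:R by rewrite ler1n.
set t := _%:R; nra.
Qed.

(** * The algorithm and its guarantees *)

Definition coin_tossing (R : realType) (n : nat) (Delta delta : R) : algorithm :=
  let L := ln (2 / confidence delta) in
  Rand (fun i : 'I_(dilution delta).+1 =>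
    contest (budget Delta L) (margin Delta L)
      (residue_mask (dilution delta).+1 n i)).

Theorem propositionA10 (R : realType) :
  exists (A : nat -> R -> R -> algorithm) (C : R),
    0 < C /\
    forall (n : nat) (Delta delta : R) (p : 'I_n -> R) (stream : seq 'I_n)
           (best : 'I_n),
      (forall i, 0 <= p i <= 1) ->
      0 < Delta -> gap p = Delta ->
      0 < delta < 1 ->
      perm_eq stream (enum 'I_n) ->
      (forall i, p i <= p best) ->
      [/\ 1 - delta <= output_prob p (A n Delta delta) (start stream) best,
          (tosses (A n Delta delta))%:R
            <= C * (n%:R / Delta ^+ 2 * ln (1 / delta))
        & (peak_memory (A n Delta delta) (start stream)
            <= (log_star (n%:R : R)).+1)%N].

Proof.
(* [102 = 6 * 17] comes from [tosses_contest] and [budget_le], [12] from [dilution_cost]. *)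
exists (@coin_tossing R), (102 * 12); split; first by rewrite mulr_gt0 ?ltr0n.
move=> n Delta delta p stream best p01 D0 gapE d01 perm_stream p_le.
have D01 : 0 < Delta <= 1 by rewrite D0 -gapE gap_le1.
have gapP c : c != best -> Delta <= p best - p c.
  by move=> cb; rewrite -gapE gap_le.
have /andP[d0 d1] := d01.
have c0 : 0 < confidence delta by rewrite lt_min d0; lra.
have c2 : confidence delta <= 1 / 2 by rewrite ge_min lexx orbT.
set L := ln (2 / confidence delta).
have L12 : 1 / 2 <= L.
  apply: le_trans (ln_ge_1BV _); last by rewrite divr_gt0.
  by rewrite invf_div; lra.
have L0 : 0 < L by lra.
have expL : expR (- L) = confidence delta / 2.
  by rewrite expRN lnK ?posrE ?divr_gt0 // invf_div.
set b := budget Delta L; set h := margin Delta L; set M := (dilution delta).+1.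
have size_stream : size stream = n by rewrite (perm_size perm_stream) size_enum_ord.
have uniq_stream : uniq stream by rewrite (perm_uniq perm_stream) enum_uniq.
have best_stream : best \in stream by rewrite (perm_mem perm_stream) mem_enum.
split.
- apply: le_trans (dilution_success d01) _ => /=.
  rewrite ler_wpM2r ?invr_ge0 ?ler0n //.
  have lt_iM : (index best stream %% M < M)%N by rewrite ltn_pmod.
  (* Only the draw of the class containing the best coin is kept. *)
  rewrite (bigD1 (Ordinal lt_iM)) //=.
  apply: ler_wpDr; first by apply: sumr_ge0 => i _; apply: output_prob_ge0.
  (* [expR (- L)] is half the allowed failure probability, one half for each term of
     [loss_contest]. *)
  rewrite lerBlDr -lerBlDl [leRHS]splitr -expL.
  apply: le_trans (lerD (margin_inv_le L D01) (budget_decay_le D01 L0)).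
  have := @loss_contest R _ p p01 Delta best b h D01 gapP (budget_refill L D01)
    (residue_mask M n (index best stream %% M)) (start stream).
  rewrite size_map size_iota.
  apply=> //; exact: mem_residue_mask.
- have tosses_le : (tosses (coin_tossing n Delta delta) * M <= 6 * b * n)%N.
    rewrite /= -leq_divRL //; apply/bigmax_leqP => i _; rewrite leq_divRL //.
    apply: leq_trans (leq_mul (tosses_contest _ _ _) (leqnn _)) _.
    by rewrite -mulnA leq_mul2l count_residue_mask orbT.
  have M0 : 0 < M%:R :> R by rewrite ltr0n.
  have := dilution_cost d01; rewrite -/L -/M => costL.
  have tosses_leR : (tosses (coin_tossing n Delta delta))%:R * M%:R
      <= 6 * b%:R * n%:R :> R by rewrite -!natrM ler_nat.
  apply: (@le_trans _ _ (6 * b%:R * n%:R / M%:R)); first by rewrite ler_pdivlMr.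
  have nD0 : 0 <= n%:R / Delta ^+ 2 :> R by rewrite divr_ge0 ?exprn_ge0 // ltW.
  apply: (@le_trans _ _ (102 * (n%:R / Delta ^+ 2) * (L / M%:R))).
    have -> : 102 * (n%:R / Delta ^+ 2) * (L / M%:R) =
      (17 * L / Delta ^+ 2) * (6 * n%:R / M%:R).
      by field; rewrite !gt_eqF.
    have -> : 6 * b%:R * n%:R / M%:R = b%:R * (6 * n%:R / M%:R) :> R by ring.
    rewrite ler_wpM2r ?divr_ge0 ?mulr_ge0 //.
    exact: budget_le.
  have := ler_wpM2l nD0 costL; lra.
- apply: (@leq_trans #|` [fset 0%N]%fset|); last by rewrite cardfs1.
  apply: peak_memory_le => /=; first by rewrite fsub0set.
  by move=> i; apply: stores_within_contest.
Qed.
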